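(* Consider contextual bilateral trade: the seller has an unknown vector $\theta^s\in\mathbb B_d$, the buyer an unknown vector $\theta^b\in\mathbb B_d$, and in round $t$ a context $x_t\in\mathbb B_d$ (chosen adversarially, revealed before pricing) determines cost $c_t=\langle\theta^s,x_t\rangle$ and value $v_t=\langle\theta^b,x_t\rangle$. Run the following algorithm (Multi-Scale Steiner GFT Maximization). Let $\Phi_1=\mathbb B_d$ and $\delta_\ell=2^{-\ell}/(8d)$. In round $t$, let $\ell_t$ be the largest integer with $w_{\Phi_t}(x_t)\le 2^{-\ell_t}$ (if the width is $0$, post an arbitrary price), and post the single price $y_t$ defined by $\mathrm{vol}(\{\theta\in\Phi_t+\delta_{\ell_t}\mathbb B_d:\langle\theta,x_t\rangle\ge y_t\})=\frac12\mathrm{vol}(\Phi_t+\delta_{\ell_t}\mathbb B_d)$. If the seller accepts and the buyer rejects, set $\Phi_{t+1}=\{\theta\in\Phi_t:\langle\theta,x_t\rangle\le y_t\}$; if the seller rejects and the buyer accepts, set $\Phi_{t+1}=\{\theta\in\Phi_t:\langle\theta,x_t\rangle\ge y_t\}$; otherwise $\Phi_{t+1}=\Phi_t$. Then the cumulative gains-from-trade regret is $O(d\log d)$, independent of $T$ and of the context sequence.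
   Context: $\mathbb B_d$ is the closed unit Euclidean ball in $\mathbb R^d$; $A+rB_d$ denotes Minkowski sum; $\mathrm{vol}$ is $d$-dimensional volume. The width of a convex set $K$ in direction $x$ is $w_K(x)=\max_{\theta_1,\theta_2\in K}\langle\theta_1-\theta_2,x\rangle$. The seller accepts price $y$ iff $y\ge c_t$, the buyer iff $y\le v_t$; a trade in round $t$ yields GFT $v_t-c_t$, else $0$. Round-$t$ regret is $\max\{v_t-c_t,0\}$ minus the realized GFT; cumulative regret is the sum over rounds. *)

(* Defs.v *)
From HB Require Import structures.
From mathcomp Require Import all_boot all_order all_algebra.
From mathcomp Require Import all_classical all_reals all_analysis.

Set Implicit Arguments.
Unset Strict Implicit.
Unset Printing Implicit Defensive.

Import Order.TTheory GRing.Theory Num.Theory.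
Local Open Scope classical_set_scope.
Local Open Scope ring_scope.

Section contextual_bilateral_trade.
Variable R : realType.

Definition dotp (d : nat) (a b : d.-tuple R) : R :=
  \sum_(i < d) tnth a i * tnth b i.

Definition unit_ball (d : nat) : set (d.-tuple R) :=
  [set th | dotp th th <= 1].

Definition mink_ball (d : nat) (A : set (d.-tuple R)) (r : R) : set (d.-tuple R) :=
  [set th | exists a, A a /\ exists b, unit_ball b /\
            th = [tuple tnth a i + r * tnth b i | i < d]].

(* width of K in direction x : max over th1, th2 in K of <th1 - th2, x>
   (K is always compact here, so the max is the supremum) *)
Definition width (d : nat) (K : set (d.-tuple R)) (x : d.-tuple R) : R :=
  sup [set dotp t1 x - dotp t2 x | t1 in K & t2 in K].

(* d-dimensional Lebesgue volume, as the iterated Lebesgue integral of the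
   indicator over the d coordinates (Tonelli). *)
Fixpoint iter_int (n : nat) : (n.-tuple R -> \bar R) -> \bar R :=
  match n with
  | 0 => fun f => f [tuple]
  | m.+1 => fun f =>
      (\int[@lebesgue_measure R]_x iter_int (fun t : m.-tuple R => f (cons_tuple x t)))%E
  end.

Definition vol (d : nat) (A : set (d.-tuple R)) : \bar R :=
  iter_int (fun t : d.-tuple R => (\1_A t)%:E).

Definition delta (d : nat) (l : int) : R := (2 ^ (- l)) / (8 * d%:R).

Definition largest_scale (w : R) (l : int) : Prop :=
  w <= 2 ^ (- l) /\ forall l' : int, w <= 2 ^ (- l') -> (l' <= l)%R.

(* seller accepts price y iff y >= c; buyer accepts iff y <= v *)
Definition gft (c v y : R) : R := if (c <= y) && (y <= v) then v - c else 0.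

Definition round_regret (c v y : R) : R := Num.max (v - c) 0 - gft c v y.

Definition update (d : nat) (Phi : set (d.-tuple R)) (x : d.-tuple R) (c v y : R)
  : set (d.-tuple R) :=
  if (c <= y) && ~~ (y <= v) then [set th | Phi th /\ dotp th x <= y]
  else if ~~ (c <= y) && (y <= v) then [set th | Phi th /\ y <= dotp th x]
  else Phi.

(* (Phi, y) is a run of Multi-Scale Steiner GFT Maximization on the instance
   (ths, thb, x).  Round t+1 of the paper is index t here. *)
Definition msgft_run (d : nat) (ths thb : d.-tuple R) (x : nat -> d.-tuple R)
  (Phi : nat -> set (d.-tuple R)) (y : nat -> R) : Prop :=
  Phi 0%N = @unit_ball d /\
  forall t : nat,
    (0 < width (Phi t) (x t) ->
       forall l : int, largest_scale (width (Phi t) (x t)) l ->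
       vol [set th | mink_ball (Phi t) (delta d l) th /\ y t <= dotp th (x t)]
       = (((2 : R)^-1)%:E * vol (mink_ball (Phi t) (delta d l)))%E) /\
    Phi t.+1 = update (Phi t) (x t) (dotp ths (x t)) (dotp thb (x t)) (y t).

End contextual_bilateral_trade.

Arguments unit_ball {R} d.
Arguments delta {R} d l.

(* Main.v *)
(** While both parameters stay in [Phi_t], a round costs something only when
    exactly one side accepts, and then at most the width, hence at most
    [2 ^ (- l)] at scale [l].  Such a round multiplies the volume of
    [Phi_t + delta_l B] by at most [7 / 8]: with [K = Phi_t + delta_l B] halved
    at level [y], a point of [K] lying at distance more than [2 d delta_l] from
    level [y] is the centre of a homothety of ratio close to [1] which moves
    level [y + delta_l] across level [y] (or conversely), and so changes
    volumes by a factor bounded independently of [d].  At scale [l] the volume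
    stays between [delta_l ^ d vol B] and [(1 + delta_l) ^ d vol B], so
    [ln vol] can drop only [O(d (l + 1 + ln d))] times, and summing against
    [2 ^ (- l)] gives [O(d (1 + ln d))].

    Only volumes of convex sets occur, so measurability of sections is
    obtained from convexity alone: if [p] is in the projection of a convex [A],
    then [vol A_x / |x - p| ^ n] is monotone on either side of [p]. *)

Require Import Defs.
From HB Require Import structures.
From mathcomp Require Import all_boot all_order all_algebra.
From mathcomp Require Import all_classical all_reals all_analysis.
From mathcomp Require Import measurable_realfun ring lra.
Import Order.TTheory GRing.Theory Num.Theory.
Local Open Scope classical_set_scope.
Local Open Scope ring_scope.

(** * Integration and measurability on the real line *)

Section line.
Set Implicit Arguments.
Unset Strict Implicit.
Unset Printing Implicit Defensive.
Context {R : realType}.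
Local Notation mu := (@lebesgue_measure R).

(** The image of Lebesgue measure under the affine map, multiplied by [m], gives half-open intervals
    their length, so by uniqueness it is Lebesgue measure itself. *)
Lemma ge0_integral_affine (f : R -> \bar R) (c m : R) :
  0 < m -> measurable_fun [set: R] f -> (forall x, 0 <= f x)%E ->
  (\int[mu]_x f (m * x + c)%R = (m^-1)%:E * \int[mu]_x f x)%E.
Proof.
move=> m0 mf f0.
pose phi : measurableTypeR R -> measurableTypeR R := fun x => m * x + c.
have mphi : measurable_fun setT phi.
  by apply: measurable_funD => //; apply: measurable_funM.
pose nu : {measure set (measurableTypeR R) -> \bar R} :=
  mscale (NngNum (ltW m0)) (pushforward mu phi).
have E A : measurable A -> mu A = nu mphi A.
  apply: lebesgue_measure_unique => _ [[a b]] _ <-.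
  change (mu `]a, b] = m%:E * mu (phi @^-1` `]a, b]))%E.
  have -> : phi @^-1` [set` `]a, b] ] = [set` `](a - c) / m, (b - c) / m] ].
    apply/seteqP; split => x /=; rewrite !in_itv/= /phi;
      rewrite ltr_pdivrMr// ler_pdivlMr// ![x * m]mulrC ltrBlDr lerBrDr //.
  rewrite !lebesgue_measure_itv/= !lte_fin ltr_pM2r ?invr_gt0// ltrBlDr subrK.
  case: ifP => ab; last by rewrite mule0.
  rewrite -!EFinB -EFinM; congr (_%:E).
  by field; rewrite gt_eqF.
have -> : (\int[mu]_x f x = \int[nu mphi]_x f x)%E.
  by apply: eq_measure_integral => A mA _; exact: E.
rewrite ge0_integral_mscale// ge0_integral_pushforward//.
rewrite muleA -EFinM mulVf ?gt_eqF// mul1e; exact: eq_integral.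
Qed.

(** On either side of [p], the quotient of [phi x] by [|x - p| ^ n] does not increase with the
    distance to [p]. On an interval avoiding [p] its superlevel sets are therefore intervals, and
    multiplying back by a continuous factor keeps measurability. *)
Lemma measurable_star_shaped (phi : R -> \bar R) (p : R) (n : nat) :
  (forall x : R, 0 <= phi x)%E ->
  (forall x l : R, (0 < l <= 1)%R -> (l ^+ n)%:E * phi x <= phi (l * x + (1 - l) * p)%R)%E ->
  measurable_fun [set: R] phi.
Proof.
move=> phi0 phiP.
have H (D : set R) : is_interval D -> ~ D p -> measurable_fun D phi.
  move=> iD Dp.
  have mD : measurable D by exact: is_interval_measurable.
  pose psi x := (((`|x - p| ^+ n)^-1)%:E * phi x)%E.
  have psiP x l : 0 < l <= 1 -> x != p -> (psi x <= psi (l * x + (1 - l) * p)%R)%E.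
    move=> l01 xp; rewrite /psi.
    have -> : l * x + (1 - l) * p - p = l * (x - p) by ring.
    have l0 : 0 < l by case/andP: l01.
    have xp0 : 0 < `|x - p| by rewrite normr_gt0 subr_eq0.
    rewrite normrM (gtr0_norm l0) exprMn.
    apply: le_trans (lee_wpmul2l _ (phiP x l l01)); last first.
      by rewrite lee_fin invr_ge0 mulr_ge0// exprn_ge0// ltW.
    rewrite muleA -EFinM invfM mulrAC mulVf ?mul1r// expf_neq0// gt_eqF//.
  have mpsi : measurable_fun D psi.
    apply: (measurability _ (ErealGenOInfty.measurableE R)) => //= _ [_ [r ->]] <-.
    apply: is_interval_measurable => s t /= [Ds] + [Dt].
    rewrite !in_itv/= !andbT => ss tt u /andP[su ut].
    have Du : D u by apply: (iD s t) => //; rewrite su ut.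
    split => //; rewrite in_itv/= andbT.
    (* The point [u] is a contraction towards [p] of whichever of [s] and [t] lies farther from
       [p]. *)
    have [ps|sp|ps] := ltgtP p s; last by move: Dp; rewrite ps.
    - have pt : 0 < t - p by rewrite subr_gt0; exact: lt_le_trans ps (le_trans su ut).
      apply: (lt_le_trans tt).
      have -> : u = ((u - p) / (t - p)) * t + (1 - (u - p) / (t - p)) * p.
        by field; rewrite gt_eqF.
      apply: psiP; last by rewrite -subr_eq0 gt_eqF.
      rewrite divr_gt0 ?ler_pdivrMr ?mul1r ?lerB// subr_gt0.
      exact: lt_le_trans ps su.
    - have tp : t < p.
        by rewrite ltNge; apply/negP => pt; apply: Dp; apply: (iD s t) => //; rewrite ltW.
      have ps : 0 < p - s by rewrite subr_gt0.
      apply: (lt_le_trans ss).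
      have -> : u = ((p - u) / (p - s)) * s + (1 - (p - u) / (p - s)) * p.
        by field; rewrite gt_eqF.
      apply: psiP; last by rewrite lt_eqF.
      rewrite divr_gt0 ?ler_pdivrMr ?mul1r ?lerB// subr_gt0.
      exact: le_lt_trans ut tp.
  apply: (eq_measurable_fun (fun x : R => (`|x - p| ^+ n)%:E * psi x)%E).
    move=> x; rewrite inE => Dx; rewrite /psi muleA -EFinM divff ?mul1e//.
    by rewrite expf_neq0// normr_eq0 subr_eq0; apply/eqP => xp; apply: Dp; rewrite -xp.
  apply: emeasurable_funM => //.
  apply/measurable_EFinP; apply: measurable_funX.
  by apply: measurableT_comp => //; apply: measurable_funD.
have -> : [set: R] = (`]-oo, p[ `|` [set p]) `|` `]p, +oo[.
  apply/esym/seteqP; split=> // x _.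
  by have [xp|px|->] := ltgtP x p; [left; left|right|left; right];
    rewrite /= ?in_itv/= ?andbT.
have [iN iy] : is_interval `]-oo, p[%classic /\ is_interval `]p, +oo[%classic.
  by split; exact: interval_is_interval.
apply/measurable_funU => //; first exact: measurableU.
split; last by apply: H => //=; rewrite in_itv/= ltxx.
apply/measurable_funU => //; split; last exact: measurable_fun_set1.
by apply: H => //=; rewrite in_itv/= ltxx.
Qed.

End line.

(** * Volumes of convex sets *)

Section convex_volume.
Set Implicit Arguments.
Unset Strict Implicit.
Unset Printing Implicit Defensive.
Context {R : realType}.
Local Notation mu := (@lebesgue_measure R).

(** Coefficients [l] and [1 - l] give convex combinations; coefficients [m] and [1] give the map of
    ratio [m] followed by a translation. *)
Definition lcomb {n} (a : R) (u : n.-tuple R) (b : R) (v : n.-tuple R) :=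
  [tuple a * tnth u i + b * tnth v i | i < n].

Definition tconvex {n} (A : set (n.-tuple R)) :=
  forall u v l, A u -> A v -> 0 <= l <= 1 -> A (lcomb l u (1 - l) v).

(** The first coordinate is fixed because [iter_int] integrates it outermost, which makes
    [vol_slice] hold by computation. *)
Definition slice {n} (A : set (n.+1.-tuple R)) (x : R) : set (n.-tuple R) :=
  [set t | A (cons_tuple x t)].

Lemma lcomb_cons n a b x y (u v : n.-tuple R) :
  lcomb a (cons_tuple x u) b (cons_tuple y v) =
  cons_tuple (a * x + b * y) (lcomb a u b v).
Proof.
apply/eq_from_tnth => i; rewrite tnth_mktuple.
by have [j ->|->] := unliftP ord0 i; rewrite ?tnthS ?tnth0// tnth_mktuple.
Qed.

Lemma tconvex_slice n (A : set (n.+1.-tuple R)) x : tconvex A -> tconvex (slice A x).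
Proof.
move=> cA u v l Au Av l01; rewrite /slice/=.
have -> : x = l * x + (1 - l) * x by ring.
by rewrite -lcomb_cons; exact: cA.
Qed.

Lemma tconvex_preimage_lcomb n (A : set (n.-tuple R)) m c :
  tconvex A -> tconvex [set t | A (lcomb m t 1 c)].
Proof.
move=> cA u v l Au Av l01 /=.
have -> : lcomb m (lcomb l u (1 - l) v) 1 c =
          lcomb l (lcomb m u 1 c) (1 - l) (lcomb m v 1 c).
  by apply/eq_from_tnth => i; rewrite !tnth_mktuple; ring.
exact: cA.
Qed.

Lemma tconvexI n (A B : set (n.-tuple R)) : tconvex A -> tconvex B -> tconvex (A `&` B).
Proof.
by move=> cA cB u v l [Au Bu] [Av Bv] l01; split; [exact: cA|exact: cB].
Qed.

Lemma vol_slice n (A : set (n.+1.-tuple R)) :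
  vol A = (\int[mu]_x vol (slice A x))%E.
Proof. by []. Qed.

Lemma vol_ge0 n (A : set (n.-tuple R)) : (0 <= vol A)%E.
Proof.
elim: n A => [|n IH] A; first by rewrite /vol/= lee_fin indicE ler0n.
by rewrite vol_slice; apply: integral_ge0 => x _; exact: IH.
Qed.

(* Monotonicity and scaling go by a simultaneous induction: in dimension [n]
   they give measurable sections in dimension [n.+1], hence the integrals that
   the next step manipulates. *)
Let vol_le_spec n := forall A B : set (n.-tuple R),
  tconvex A -> tconvex B -> A `<=` B -> (vol A <= vol B)%E.
Let vol_scale_spec n := forall (A : set (n.-tuple R)) (m : R) c, tconvex A -> 0 < m ->
  vol [set t | A (lcomb m t 1 c)] = ((m^-1 ^+ n)%:E * vol A)%E.
Let measurable_spec n := forall A : set (n.+1.-tuple R), tconvex A ->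
  measurable_fun [set: R] (fun x => vol (slice A x)).

Let vol_homothety_spec n : vol_le_spec n -> vol_scale_spec n ->
  forall (A B : set (n.-tuple R)) (l : R) c, tconvex A -> tconvex B -> 0 < l ->
  (forall u, A u -> B (lcomb l u 1 c)) -> ((l ^+ n)%:E * vol A <= vol B)%E.
Proof.
move=> mon sca A B l c cA cB l0 AB.
have := mon _ _ cA (@tconvex_preimage_lcomb _ _ l c cB) AB.
rewrite sca// => /(lee_wpmul2l (_ : (0 <= (l ^+ n)%:E)%E)).
rewrite lee_fin exprn_ge0 ?(ltW l0)// => /(_ isT) /le_trans; apply.
by rewrite muleA -EFinM -exprMn divff ?gt_eqF// expr1n mul1e.
Qed.

Let measurable_spec_step n : vol_le_spec n -> vol_scale_spec n -> measurable_spec n.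
Proof.
move=> mon sca A cA.
have [[p [q Apq]]|A0] := pselect (exists p q, A (cons_tuple p q)); last first.
  apply: (eq_measurable_fun (cst (vol (set0 : set (n.-tuple R))))) => // x _ /=.
  by congr vol; apply/seteqP; split => // t At; apply: A0; exists x, t.
(* Contracting towards the point [(p, q)] of [A] by the ratio [l] sends the slice at [x] into the
   slice at [l * x + (1 - l) * p]. *)
apply: (@measurable_star_shaped _ _ p n) => [x|x l /andP[l0 l1]]; first exact: vol_ge0.
apply: (@vol_homothety_spec n mon sca _ _ l (lcomb (1 - l) q 0 q)) => //.
- exact: tconvex_slice.
- exact: tconvex_slice.
- move=> u Au; rewrite /slice/=.
  have -> : lcomb l u 1 (lcomb (1 - l) q 0 q) = lcomb l u (1 - l) q.
    by apply/eq_from_tnth => i; rewrite !tnth_mktuple; ring.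
  by rewrite -lcomb_cons; apply: cA => //; rewrite ltW.
Qed.

Let vol_specs n : vol_le_spec n /\ vol_scale_spec n.
Proof.
elim: n => [|n [mon sca]].
  split => [A B _ _ AB|A m c _ _].
    rewrite /vol/= lee_fin !indicE ler_nat; case: (boolP (_ \in A)) => //.
    by rewrite inE => /AB; rewrite -inE => ->.
  rewrite /vol/= expr0 mul1e !indicE; congr (_%:R%:E); congr nat_of_bool.
  by congr asbool; congr (A _); apply/eq_from_tnth; case.
have meas := @measurable_spec_step n mon sca.
split => [A B cA cB AB|A m c cA m0]; rewrite !vol_slice.
  apply: ge0_le_integral => //= [x _|||x _].
  - exact: vol_ge0.
  - exact: meas.
  - exact: meas.
  - by apply: mon => [||t]; [exact: tconvex_slice..|exact: AB].
(* The induction hypothesis scales the last [n] coordinates; the affine change of variable in the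
   first one supplies the remaining factor [m^-1]. *)
case/tupleP: c => c0 c'.
under eq_integral => x _.
  have -> : slice [set t | A (lcomb m t 1 [tuple of c0 :: c'])] x =
            [set t | slice A (m * x + c0) (lcomb m t 1 c')].
    by apply/seteqP; split=> t; rewrite /slice/= lcomb_cons mul1r.
  rewrite sca//; last exact: tconvex_slice.
  over.
rewrite (@ge0_integral_affine _ (fun y => (m^-1 ^+ n)%:E * vol (slice A y))%E)//.
- rewrite ge0_integralZl//.
  + by rewrite muleA -EFinM exprS.
  + exact: meas.
  + by move=> x _; exact: vol_ge0.
  + by rewrite lee_fin exprn_ge0// invr_ge0 ltW.
- by apply: measurable_funeM; exact: meas.
- move=> x; rewrite mule_ge0 ?vol_ge0// lee_fin exprn_ge0// invr_ge0 ltW//.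
Qed.

Lemma le_vol n (A B : set (n.-tuple R)) :
  tconvex A -> tconvex B -> A `<=` B -> (vol A <= vol B)%E.
Proof. exact: (vol_specs n).1. Qed.

Lemma measurable_vol_slice n (A : set (n.+1.-tuple R)) :
  tconvex A -> measurable_fun [set: R] (fun x => vol (slice A x)).
Proof. by case: (vol_specs n) => mon sca; exact: measurable_spec_step. Qed.

Lemma vol_homothety n (A B : set (n.-tuple R)) (l : R) c :
  tconvex A -> tconvex B -> 0 < l ->
  (forall u, A u -> B (lcomb l u 1 c)) -> ((l ^+ n)%:E * vol A <= vol B)%E.
Proof. by case: (vol_specs n) => mon sca; exact: vol_homothety_spec. Qed.

(** By induction on slices: convexity of each piece makes its slice volumes measurable, so the
    integrals add. *)
Lemma volU n (A B : set (n.-tuple R)) :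
  tconvex A -> tconvex B -> A `&` B = set0 -> vol (A `|` B) = (vol A + vol B)%E.
Proof.
elim: n A B => [|n IH] A B cA cB AB.
  rewrite /vol/= !indicE in_setU -EFinD -natrD.
  case: (boolP (_ \in A)) => [|_]; case: (boolP (_ \in B)) => //= /[!inE] Bt At.
  by exfalso; rewrite -[False]/(set0 [tuple of [::] : seq R]) -AB.
rewrite !vol_slice -ge0_integralD//.
- apply: eq_integral => x _; rewrite -IH//; try exact: tconvex_slice.
  by apply/seteqP; split=> // t ABt; have : (A `&` B) (cons_tuple x t) by []; rewrite AB.
- by move=> x _; exact: vol_ge0.
- exact: measurable_vol_slice.
- by move=> x _; exact: vol_ge0.
- exact: measurable_vol_slice.
Qed.

(** Comparison body that shows the volume of the unit ball to be positive and finite. *)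
Definition cube n (a b : R) : set (n.-tuple R) :=
  [set t | forall i, a <= tnth t i <= b].

Lemma tconvex_cube n a b : tconvex (@cube n a b).
Proof.
move=> u v l Au Av /andP[l0 l1] i; rewrite tnth_mktuple.
have /andP[u1 u2] := Au i; have /andP[v1 v2] := Av i.
by apply/andP; split; nra.
Qed.

Lemma vol_set0 n : vol (set0 : set (n.-tuple R)) = 0%E.
Proof.
elim: n => [|n IH]; first by rewrite /vol/= indic0.
by rewrite vol_slice; under eq_integral do [rewrite IH]; exact: integral0.
Qed.

Lemma vol_cube n (a b : R) : a <= b -> vol (@cube n a b) = ((b - a) ^+ n)%:E.
Proof.
move=> ab; elim: n => [|n IH].
  by rewrite /vol/= indicE mem_set ?expr0// => -[].
have E x : vol (slice (@cube n.+1 a b) x) = (((b - a) ^+ n)%:E * (\1_`[a, b] x)%:E)%E.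
  rewrite indicE; have [xab|xab] := boolP (x \in _).
    rewrite mule1 -IH; congr vol; apply/seteqP; split => t tab i.
      by have := tab (lift ord0 i); rewrite tnthS.
    have [j ->|->] := unliftP ord0 i; rewrite ?tnthS ?tnth0//.
    by move: xab; rewrite inE/= in_itv.
  rewrite mule0 -(vol_set0 n); congr vol; apply/seteqP; split => // t /(_ ord0).
  by rewrite tnth0 => xab'; move/negP: xab; apply; rewrite inE/= in_itv.
rewrite vol_slice; under eq_integral do [rewrite E].
rewrite ge0_integralZl//; first last.
- by rewrite lee_fin exprn_ge0// subr_ge0.
- by apply/measurable_EFinP.
rewrite integral_indic// setIT/= lebesgue_measure_itv/= lte_fin exprSr EFinM.
by move: ab; rewrite le_eqVlt => /orP[/eqP->|->//]; rewrite ltxx subrr.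
Qed.

End convex_volume.

(** * Halfspaces, balls and homotheties *)

Section geometry.
Set Implicit Arguments.
Unset Strict Implicit.
Unset Printing Implicit Defensive.
Context {R : realType}.

Lemma dotp_lcomb n a b (u v x : n.-tuple R) :
  dotp (lcomb a u b v) x = a * dotp u x + b * dotp v x.
Proof.
rewrite /dotp !mulr_sumr -big_split/=; apply: eq_bigr => i _.
by rewrite tnth_mktuple; ring.
Qed.

Lemma dotpC n (u v : n.-tuple R) : dotp u v = dotp v u.
Proof. by apply: eq_bigr => i _; rewrite mulrC. Qed.

Lemma dotp_ge0 n (u : n.-tuple R) : 0 <= dotp u u.
Proof. by apply: sumr_ge0 => i _; rewrite -expr2 sqr_ge0. Qed.

(** Instead of Cauchy-Schwarz, the squared norms of [u + v] and [u - v] are expanded; both are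
    nonnegative. *)
Lemma dotp_unit_ball n (u v : n.-tuple R) :
  unit_ball n u -> unit_ball n v -> -1 <= dotp u v <= 1.
Proof.
rewrite /unit_ball/= => u1 v1.
have := dotp_ge0 (lcomb 1 u 1 v); have := dotp_ge0 (lcomb 1 u (-1) v).
rewrite !dotp_lcomb ![dotp _ (lcomb _ _ _ _)]dotpC !dotp_lcomb (dotpC v u).
by move=> H1 H2; apply/andP; split; lra.
Qed.

Lemma tconvex_unit_ball n : tconvex (@unit_ball R n).
Proof.
move=> u v l u1 v1 /andP[l0 l1].
have /andP[_ uv] := dotp_unit_ball u1 v1; move: u1 v1; rewrite /unit_ball/=.
rewrite !dotp_lcomb ![dotp _ (lcomb _ _ _ _)]dotpC !dotp_lcomb (dotpC v u).
move=> u1 v1.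
have h1 : l * l * dotp u u <= l * l * 1 by rewrite ler_wpM2l ?mulr_ge0.
have h2 : l * (1 - l) * dotp u v <= l * (1 - l) * 1.
  by rewrite ler_wpM2l ?mulr_ge0 ?subr_ge0.
have h3 : (1 - l) * (1 - l) * dotp v v <= (1 - l) * (1 - l) * 1.
  by rewrite ler_wpM2l ?mulr_ge0 ?subr_ge0.
lra.
Qed.

Lemma unit_ball0 n : unit_ball n [tuple 0 : R | i < n].
Proof.
rewrite /unit_ball/= /dotp big1 ?ler01// => i _.
by rewrite tnth_mktuple mulr0.
Qed.

Lemma mink_ballE n (A : set (n.-tuple R)) r th :
  mink_ball A r th <-> exists a b, [/\ A a, unit_ball n b & th = lcomb 1 a r b].
Proof.
have E a b : [tuple tnth a i + r * tnth b i | i < n] = lcomb 1 a r b.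
  by apply/eq_from_tnth => i; rewrite !tnth_mktuple mul1r.
split => [[a [Aa [b [b1 ->]]]]|[a [b [Aa b1 ->]]]]; first by exists a, b.
by exists a; split => //; exists b.
Qed.

Lemma mink_ball_sub n (A B : set (n.-tuple R)) r :
  A `<=` B -> mink_ball A r `<=` mink_ball B r.
Proof. by move=> AB th [a [Aa H]]; exists a; split => //; exact: AB. Qed.

Lemma sub_mink_ball n (A : set (n.-tuple R)) r : A `<=` mink_ball A r.
Proof.
move=> a Aa; apply/mink_ballE; exists a, [tuple 0 | i < n]; split => //.
  exact: unit_ball0.
by apply/eq_from_tnth => i; rewrite !tnth_mktuple; ring.
Qed.

Lemma tconvex_mink_ball n (A : set (n.-tuple R)) r :
  tconvex A -> tconvex (mink_ball A r).
Proof.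
move=> cA u v l /mink_ballE[a [b [Aa b1 ->]]] /mink_ballE[a' [b' [Aa' b1' ->]]] l01.
apply/mink_ballE; exists (lcomb l a (1 - l) a'), (lcomb l b (1 - l) b'); split.
- exact: cA.
- exact: tconvex_unit_ball.
- by apply/eq_from_tnth => i; rewrite !tnth_mktuple; ring.
Qed.

(** The ball contains the cube with side from [0] to [1/n] and lies in the cube with side from [-1]
    to [1]. *)
Lemma vol_unit_ball n : (0 < n)%N ->
  exists2 B : R, 0 < B & vol (@unit_ball R n) = B%:E.
Proof.
move=> n0; have n0R : 0 < n%:R :> R by rewrite ltr0n.
have lo : (((n%:R^-1 : R) ^+ n)%:E <= vol (@unit_ball R n))%E.
  rewrite -[n%:R^-1 in X in (X <= _)%E]subr0 -(@vol_cube R n 0 n%:R^-1) ?invr_ge0//.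
  apply: le_vol; [exact: tconvex_cube|exact: tconvex_unit_ball|move=> t tab].
  rewrite /unit_ball/= /dotp; apply: (@le_trans _ _ (\sum_(i < n) n%:R^-1)).
    apply: ler_sum => i _; have /andP[t0 t1] := tab i.
    have n1 : n%:R^-1 <= 1 :> R by rewrite invf_le1// ler1n.
    nra.
  by rewrite sumr_const card_ord -[_ *+ n]mulr_natl divff// gt_eqF.
have hi : (vol (@unit_ball R n) <= ((1 - -1 : R) ^+ n)%:E)%E.
  rewrite -vol_cube; last by lra.
  apply: le_vol; [exact: tconvex_unit_ball|exact: tconvex_cube|move=> t t1 i].
  have : tnth t i * tnth t i <= 1.
    apply: le_trans t1; rewrite /dotp (bigD1 i)//= lerDl.
    by apply: sumr_ge0 => j _; rewrite -expr2 sqr_ge0.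
  by move=> ?; apply/andP; split; nra.
have fin : vol (@unit_ball R n) \is a fin_num.
  by rewrite ge0_fin_numE ?vol_ge0//; apply: le_lt_trans hi _; rewrite ltry.
exists (fine (vol (@unit_ball R n))); last by rewrite fineK.
by rewrite -lte_fin fineK//; apply: lt_le_trans lo; rewrite lte_fin exprn_gt0// invr_gt0.
Qed.

Lemma vol_mink_ball_ge n (A : set (n.-tuple R)) r p : tconvex A -> A p -> 0 < r ->
  ((r ^+ n)%:E * vol (@unit_ball R n) <= vol (mink_ball A r))%E.
Proof.
move=> cA Ap r0; apply: (@vol_homothety _ _ _ _ r p) => //.
- exact: tconvex_unit_ball.
- exact: tconvex_mink_ball.
- move=> u u1; apply/mink_ballE; exists p, u; split => //.
  by apply/eq_from_tnth => i; rewrite !tnth_mktuple; ring.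
Qed.

(** Contracting [a + r b] by [1 + r] gives a convex combination of two points of the unit ball. *)
Lemma vol_mink_ball_le n (A : set (n.-tuple R)) r : tconvex A -> A `<=` unit_ball n ->
  0 < r ->
  ((((1 + r)^-1) ^+ n)%:E * vol (mink_ball A r) <= vol (@unit_ball R n))%E.
Proof.
move=> cA A1 r0; have r1 : 0 < 1 + r by rewrite addr_gt0.
apply: (@vol_homothety _ _ _ _ _ [tuple 0 | i < n]).
- exact: tconvex_mink_ball.
- exact: tconvex_unit_ball.
- by rewrite invr_gt0.
- move=> u /mink_ballE[a [b [Aa b1 ->]]].
  have -> : lcomb (1 + r)^-1 (lcomb 1 a r b) 1 [tuple 0 | i < n] =
            lcomb (1 + r)^-1 a (1 - (1 + r)^-1) b.
    apply/eq_from_tnth => i; rewrite !tnth_mktuple; field; exact: lt0r_neq0.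
  apply: tconvex_unit_ball => //; first exact: A1.
  by rewrite invr_ge0 ltW//= invf_le1// lerDl ltW.
Qed.

(** Abstracting the form lets one volume estimate serve both the inner product with a context and
    its negative. *)
Definition tlinear n (f : n.-tuple R -> R) :=
  forall a b u v, f (lcomb a u b v) = a * f u + b * f v.

Lemma tconvex_preimage n (f : n.-tuple R -> R) (I : set R) :
  tlinear f -> is_interval I -> tconvex [set t | I (f t)].
Proof.
move=> fl iI u v l Iu Iv /andP[l0 l1] /=; rewrite fl.
have [uv|vu] := leP (f u) (f v).
  by apply: (iI _ _ Iu Iv); apply/andP; split; nra.
by apply: (iI _ _ Iv Iu); apply/andP; split; nra.
Qed.

Lemma tconvex_le n (f : n.-tuple R -> R) z : tlinear f -> tconvex [set t | f t <= z].
Proof.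
move=> fl; apply: (@tconvex_preimage n f [set a | a <= z]) => // a b _ bz c /andP[_ cb].
exact: le_trans cb bz.
Qed.

Lemma tconvex_lt n (f : n.-tuple R -> R) z : tlinear f -> tconvex [set t | f t < z].
Proof.
move=> fl; apply: (@tconvex_preimage n f [set a | a < z]) => // a b _ bz c /andP[_ cb].
exact: le_lt_trans cb bz.
Qed.

Lemma tconvex_ge n (f : n.-tuple R -> R) z : tlinear f -> tconvex [set t | z <= f t].
Proof.
move=> fl; apply: (@tconvex_preimage n f [set a | z <= a]) => // a b az _ c /andP[ac _].
exact: le_trans az ac.
Qed.

Lemma tconvex_gt n (f : n.-tuple R -> R) z : tlinear f -> tconvex [set t | z < f t].
Proof.
move=> fl; apply: (@tconvex_preimage n f [set a | z < a]) => // a b az _ c /andP[ac _].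
exact: lt_le_trans az ac.
Qed.

Lemma bernoulli_le (u : R) n : 0 <= u <= 1 -> 1 - n%:R * u <= (1 - u) ^+ n.
Proof.
move=> /andP[u0 u1]; elim: n => [|n IH]; first by rewrite mul0r subr0 expr0.
rewrite exprS; apply: (@le_trans _ _ ((1 - u) * (1 - n%:R * u))).
  rewrite -natr1; have : 0 <= n%:R :> R by []. 
  by move=> ?; nra.
by apply: ler_wpM2l => //; lra.
Qed.

(** From [1 + x <= expR x] at [x = -1/8] one gets [expR (1/8) <= 8/7], whose fourth power
    [4096/2401] is below [7/4]. *)
Lemma expR_half_le : expR (2^-1 : R) <= 7 / 4.
Proof.
have h : expR (8^-1 : R) <= 8 / 7.
  have := @expR_ge1Dx R (- 8^-1); rewrite expRN => h.
  by rewrite -[leLHS]invrK -[leRHS]invrK lef_pV2 ?posrE ?invr_gt0 ?expR_gt0//; lra.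
have -> : (2^-1 : R) = 4%:R * 8^-1 by lra.
rewrite expRM_natl; apply: (@le_trans _ _ ((8 / 7) ^+ 4)); last by lra.
by apply: lerXn2r => //; rewrite nnegrE ?expR_ge0//; lra.
Qed.

(** The power [(1 + 1/(2n)) ^ n] is at most [expR (1/2)], a bound free of the dimension. *)
Lemma contraction_pow_ge n : (0 < n)%N ->
  4 / 7 <= ((1 + (2 * n%:R : R)^-1)^-1) ^+ n.
Proof.
move=> n0; have n0R : 0 < n%:R :> R by rewrite ltr0n.
have i0 : 0 < (2 * n%:R : R)^-1 by rewrite invr_gt0 mulr_gt0.
rewrite exprVn -[leLHS]invrK lef_pV2 ?posrE ?invr_gt0 ?divr_gt0 ?exprn_gt0 ?addr_gt0//.
apply: (@le_trans _ _ (expR (2^-1))); last by rewrite invf_div; exact: expR_half_le.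
have -> : (2^-1 : R) = n%:R * (2 * n%:R)^-1 by field; exact: lt0r_neq0.
rewrite expRM_natl; apply: lerXn2r; rewrite ?nnegrE ?expR_ge0 ?addr_ge0 ?(ltW i0)//.
exact: expR_ge1Dx.
Qed.

(** Halving is stated by two inequalities so that the result also applies to the negated form, which
    exchanges strict and weak halfspaces. *)
Lemma vol_halfspace_slack n (K : set (n.-tuple R)) (f : n.-tuple R -> R)
    (y s V : R) (p q : n.-tuple R) :
  (0 < n)%N -> tconvex K ->
  tlinear f ->
  K p -> K q -> 4 * n%:R * s < f q - f p -> 0 <= s ->
  vol K = V%:E ->
  (vol (K `&` [set t | f t < y]%R) <= (V / 2)%:E)%E ->
  ((V / 2)%:E <= vol (K `&` [set t | y <= f t]%R))%E ->
  (vol (K `&` [set t | f t <= y + s]%R) <= (7 / 8 * V)%:E)%E.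
Proof.
move=> n0 cK fl Kp Kq W s0 KV lo hi.
have n0R : 1 <= n%:R :> R by rewrite ler1n.
have n1 : 0 < n%:R :> R by rewrite ltr0n.
have cle z : tconvex (K `&` [set t | f t <= z]) by apply: tconvexI => //; exact: tconvex_le.
have clt z : tconvex (K `&` [set t | f t < z]) by apply: tconvexI => //; exact: tconvex_lt.
have cge z : tconvex (K `&` [set t | z <= f t]) by apply: tconvexI => //; exact: tconvex_ge.
have cgt z : tconvex (K `&` [set t | z < f t]) by apply: tconvexI => //; exact: tconvex_gt.
have fin (A : set (n.-tuple R)) : tconvex A -> A `<=` K ->
    exists2 v : R, 0 <= v & vol A = v%:E.
  move=> cA AK; have := le_vol cA cK AK; rewrite KV => AV.
  have fA : vol A \is a fin_num.
    by rewrite ge0_fin_numE ?vol_ge0//; apply: le_lt_trans AV _; rewrite ltry.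
  by exists (fine (vol A)); rewrite ?fineK// fine_ge0// vol_ge0.
have [v v0 Lv] := fin _ (cle (y + s)) (@subIsetl _ _ _).
pose D := (f q - f p) / 2.
have Ds : s < D / (2 * n%:R).
  by rewrite ltr_pdivlMr ?mulr_gt0//; rewrite /D; lra.
set i := (2 * n%:R : R)^-1 in Ds.
have i0 : 0 < i by rewrite invr_gt0 mulr_gt0.
have iN : i * (2 * n%:R) = 1 by rewrite mulVf// lt0r_neq0// mulr_gt0.
have i2 : i <= 1 / 2 by nra.
(* If the lower side is deep, contract [f <= y + s] into [f < y] towards [p];
   otherwise contract [y <= f] into [y + s < f] towards [q]. *)
have [yp|yp] := leP D (y - f p).
  pose l := (1 + i)^-1.
  have l0 : 0 < l by rewrite invr_gt0 addr_gt0.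
  have li : l * (1 + i) = 1 by rewrite mulVf// gt_eqF// addr_gt0.
  have l1 : l <= 1 by nra.
  have := @vol_homothety R n _ _ l (lcomb (1 - l) p 0 p) (cle (y + s)) (clt y) l0.
  rewrite Lv => /(_ _)/le_trans/(_ lo).
  have H : forall u, (K `&` [set t | f t <= y + s]) u ->
      (K `&` [set t | f t < y]) (lcomb l u 1 (lcomb (1 - l) p 0 p)).
    move=> u [Ku fu].
    have -> : lcomb l u 1 (lcomb (1 - l) p 0 p) = lcomb l u (1 - l) p.
      by apply/eq_from_tnth => j; rewrite !tnth_mktuple; ring.
    split; first by apply: cK => //; rewrite ltW.
    rewrite /= in fu *; rewrite fl.
    have : l * (f u - f p) < y - f p; last by nra.
    have : f u - f p < (y - f p) * (1 + i) by nra.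
    by rewrite -(ltr_pM2l l0) mulrCA li mulr1.
  move=> /(_ H); rewrite -EFinM !lee_fin => lV.
  (* Here [l ^ n * v <= V / 2] and [l ^ n >= 4/7], which is where [7/8] comes from. *)
  have := contraction_pow_ge n0; rewrite -/i -/l => l47.
  by nra.
pose l := 1 - i.
have l0 : 0 < l by rewrite /l; lra.
have H : forall u, (K `&` [set t | y <= f t]) u ->
    (K `&` [set t | y + s < f t]) (lcomb l u 1 (lcomb (1 - l) q 0 q)).
  move=> u [Ku fu].
  have -> : lcomb l u 1 (lcomb (1 - l) q 0 q) = lcomb l u (1 - l) q.
    by apply/eq_from_tnth => j; rewrite !tnth_mktuple; ring.
  split; first by apply: cK => //; rewrite /l; lra.
  rewrite /= in fu *; rewrite fl.
  have : D < f q - y by rewrite /D in yp *; lra.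
  by rewrite /l; nra.
have := @vol_homothety R n _ _ l _ (cge y) (cgt (y + s)) l0 H.
have [w w0 Lw] := fin _ (cgt (y + s)) (@subIsetl _ _ _).
have [g g0 Lg] := fin _ (cge y) (@subIsetl _ _ _).
move: hi; rewrite Lw Lg -EFinM !lee_fin => hi lw.
have : vol K = (v + w)%:E.
  rewrite EFinD -Lv -Lw -volU//.
    congr vol; apply/seteqP; split => [t Kt|t [[]|[]]//].
    by have [ty|ty] := leP (f t) (y + s); [left|right].
  by apply/seteqP; split => // t [[_ /= t1] [_ /= t2]]; lra.
rewrite KV => -[VE].
(* Then the part above [y + s] has volume at least [V / 4], leaving at most [3/4 * V] below. *)
have : 1 / 2 <= l ^+ n.
  apply: le_trans (bernoulli_le n _); last by lra.
  lra.
rewrite Lv lee_fin => l2; nra.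
Qed.

End geometry.

(** * Scales and potentials *)

Section regret.
Set Implicit Arguments.
Unset Strict Implicit.
Unset Printing Implicit Defensive.
Context {R : realType}.

Lemma tlinear_dotp n (x : n.-tuple R) : tlinear (fun t => dotp t x).
Proof. by move=> a b u v; exact: dotp_lcomb. Qed.

Lemma tlinear_dotpN n (x : n.-tuple R) : tlinear (fun t => - dotp t x).
Proof. by move=> a b u v; rewrite dotp_lcomb; ring. Qed.

(** Since inner products with [x] are at most [1] in absolute value on the unit ball, enlarging a
    cut set by [r] passes level [y] by at most [r]; this is the slack [s] above. *)
Lemma vol_mink_ball_cut n (A : set (n.-tuple R)) x (y r V : R) p q :
  (0 < n)%N -> tconvex A -> unit_ball n x -> 0 < r -> A p -> A q ->
  4 * n%:R * r < dotp q x - dotp p x ->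
  vol (mink_ball A r) = V%:E ->
  vol [set th | mink_ball A r th /\ y <= dotp th x] = ((2^-1)%:E * V%:E)%E ->
  (vol (mink_ball [set th | A th /\ (dotp th x <= y)%R] r) <= (7 / 8 * V)%:E)%E /\
  (vol (mink_ball [set th | A th /\ (y <= dotp th x)%R] r) <= (7 / 8 * V)%:E)%E.
Proof.
move=> n0 cA x1 r0 Ap Aq W KV half.
have lf := tlinear_dotp x; have lg := tlinear_dotpN x.
set K := mink_ball A r in KV half *.
have cK : tconvex K by exact: tconvex_mink_ball.
have Kp : K p by exact: sub_mink_ball.
have Kq : K q by exact: sub_mink_ball.
have ge_y : vol (K `&` [set t | y <= dotp t x]) = (V / 2)%:E.
  by rewrite mulrC EFinM -half.
have lt_y : vol (K `&` [set t | dotp t x < y]) = (V / 2)%:E.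
  have : vol K = (vol (K `&` [set t | dotp t x < y]%R) +
                  vol (K `&` [set t | y <= dotp t x]%R))%E.
    rewrite -volU.
    - congr vol; apply/seteqP; split => [t Kt|t [[]|[]]//].
      by have [ty|ty] := leP y (dotp t x); [right|left].
    - by apply: tconvexI => //; exact: tconvex_lt.
    - by apply: tconvexI => //; exact: tconvex_ge.
    - by apply/seteqP; split => // t [[_ /= t1] [_ /= t2]]; lra.
  rewrite ge_y KV; case: (vol _) => [v| |]//=.
  by rewrite -EFinD => -[Vv]; congr (_%:E); lra.
have c1 : tconvex [set th | A th /\ dotp th x <= y].
  by apply: (@tconvexI _ _ A [set th | dotp th x <= y]) => //; exact: tconvex_le.
have c2 : tconvex [set th | A th /\ y <= dotp th x].
  by apply: (@tconvexI _ _ A [set th | y <= dotp th x]) => //; exact: tconvex_ge.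
have bx b : unit_ball n b -> -1 <= dotp b x <= 1 by move=> b1; exact: dotp_unit_ball.
split.
- apply: (@le_trans _ _ (vol (K `&` [set t | dotp t x <= y + r]))).
    apply: le_vol.
    + exact: tconvex_mink_ball.
    + by apply: tconvexI => //; exact: tconvex_le.
    + move=> t tK; split; first by apply: mink_ball_sub tK => u [].
      move/mink_ballE: tK => [a [b [[Aa ay] b1 ->]]]; rewrite /= dotp_lcomb mul1r.
      by have /andP[_ ?] := bx b b1; apply: lerD => //; nra.
  apply: (@vol_halfspace_slack _ _ K (fun t => dotp t x) y r V p q) => //.
  + exact: ltW.
  + by rewrite lt_y.
  + by rewrite ge_y.
- apply: (@le_trans _ _ (vol (K `&` [set t | - dotp t x <= - y + r]))).
    apply: le_vol.
    + exact: tconvex_mink_ball.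
    + by apply: tconvexI => //; exact: tconvex_le.
    + move=> t tK; split; first by apply: mink_ball_sub tK => u [].
      move/mink_ballE: tK => [a [b [[Aa ay] b1 ->]]]; rewrite /= dotp_lcomb mul1r.
      by have /andP[? _] := bx b b1; nra.
  apply: (@vol_halfspace_slack _ _ K (fun t => - dotp t x) (- y) r V q p) => //.
  + by lra.
  + exact: ltW.
  + rewrite -ge_y; apply: le_vol.
    * by apply: tconvexI => //; exact: tconvex_lt.
    * by apply: tconvexI => //; exact: tconvex_ge.
    * by move=> t [Kt /= ty]; split => //=; lra.
  + rewrite -lt_y; apply: le_vol.
    * by apply: tconvexI => //; exact: tconvex_lt.
    * by apply: tconvexI => //; exact: tconvex_ge.
    * by move=> t [Kt /= ty]; split => //=; lra.
Qed.

(** Widths are at most [2], so scales start at [-1]; a natural number [k] stands for the scale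
    [k - 1]. *)
Lemma two_powerN (k : nat) : 2 ^ (- (k%:Z - 1)) = 2 * (2^-1 : R) ^+ k.
Proof. by rewrite opprB expfzDr// expr1z -exprnN exprVn. Qed.

Lemma largest_scale_exists (w : R) : 0 < w -> w <= 2 ->
  exists k : nat, [/\ largest_scale w (k%:Z - 1), w <= 2 * (2^-1) ^+ k &
                      (2^-1) ^+ k < w].
Proof.
move=> w0 w2.
have ex : exists k, (2^-1 : R) ^+ k < w.
  exists (Num.bound w^-1); rewrite exprVn -[ltRHS]invrK ltf_pV2 ?posrE ?exprn_gt0 ?invr_gt0//.
  apply: (@lt_le_trans _ _ (Num.bound w^-1)%:R).
    by have := archi_boundP (ltW (_ : 0 < w^-1)); apply; rewrite invr_gt0.
  by rewrite -natrX ler_nat ltnW// ltn_expl.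
(* Minimality of [k] gives the upper bound on [w], except at [k = 0], where it is the assumption
   [w <= 2]. *)
case: (ex_minnP ex) => k wk kmin.
have kw : w <= 2 * (2^-1) ^+ k.
  case: k wk kmin => [|k] wk kmin; first by rewrite expr0 mulr1.
  rewrite exprS mulrA mulfV// mul1r leNgt; apply/negP => /kmin.
  by rewrite ltnn.
exists k; split => //; split; first by rewrite two_powerN.
move=> l'; apply: contraTT; rewrite -!ltNge => kl.
apply: le_lt_trans wk; rewrite exprVn exprnN.
by rewrite ler_eXz2l ?ltr1n// lerN2; move: kl; rewrite ltrBlDr ltzD1.
Qed.

(** A round costing at most [w k] is paid for by a drop of at least [kappa] in the potential [P k],
    while the other potentials do not rise. *)
Lemma multiscale_sum (r : nat -> R) (P : nat -> nat -> R) (w : nat -> R) (kappa : R) :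
  0 < kappa -> (forall k, 0 <= w k) -> (forall k t, P k t.+1 <= P k t) ->
  (forall t, r t <= 0 \/ exists k, r t <= w k /\ P k t.+1 <= P k t - kappa) ->
  forall T, exists M, \sum_(t < T) r t <= kappa^-1 * \sum_(k < M) w k * (P k 0 - P k T).
Proof.
move=> k0 w0 Pni H T.
(* Asking for all larger cutoffs lets the induction raise [M] when a round uses a new scale. *)
suff [M /(_ M (leqnn _))] : exists M, forall M', (M <= M')%N ->
  \sum_(t < T) r t <= kappa^-1 * \sum_(k < M') w k * (P k 0 - P k T) by exists M.
elim: T => [|T [M IH]].
  exists 0%N => M' _; rewrite big_ord0 mulr_ge0 ?invr_ge0 ?(ltW k0)//.
  by apply: sumr_ge0 => k _; rewrite subrr mulr0.
have E M' : \sum_(k < M') w k * (P k 0 - P k T.+1) =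
    \sum_(k < M') w k * (P k 0 - P k T) + \sum_(k < M') w k * (P k T - P k T.+1).
  by rewrite -big_split/=; apply: eq_bigr => k _; ring.
have pos k : 0 <= w k * (P k T - P k T.+1) by rewrite mulr_ge0// subr_ge0.
have [r0|[k [rk Pk]]] := H T.
  exists M => M' /IH h; rewrite big_ord_recr/= E mulrDr.
  rewrite -[leLHS]addr0 -addrA; apply: lerD => //; rewrite addr0.
  by apply: le_trans r0 _; rewrite mulr_ge0 ?invr_ge0 ?(ltW k0)// sumr_ge0.
exists (maxn M k.+1) => M'; rewrite geq_max => /andP[/IH h kM].
rewrite big_ord_recr/= E mulrDr; apply: lerD => //.
apply: le_trans rk _; rewrite mulrC ler_pdivlMr//.
rewrite (bigD1 (Ordinal kM))//=; apply: (@le_trans _ _ (w k * (P k T - P k T.+1))).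
  by rewrite ler_wpM2l//; lra.
by rewrite lerDl sumr_ge0.
Qed.

Lemma geometric_moment_le (A : R) M : 0 <= A ->
  \sum_(k < M) (2^-1) ^+ k * (A + k%:R) <= 2 * A + 2.
Proof.
move=> A0.
suff -> : \sum_(k < M) (2^-1) ^+ k * (A + k%:R) =
          2 * A + 2 - (2^-1) ^+ M * (2 * A + 2 * M%:R + 2).
  by rewrite gerBl mulr_ge0// ?exprn_ge0// !addr_ge0// mulr_ge0.
elim: M => [|M IH]; first by rewrite big_ord0 expr0; ring.
by rewrite big_ord_recr/= IH exprS -natr1; field.
Qed.

Lemma deltaE d (k : nat) : delta d (k%:Z - 1) = (2^-1 : R) ^+ k / (4 * d%:R).
Proof.
rewrite /delta two_powerN (_ : 8 * d%:R = 2 * (4 * d%:R)); last by ring.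
by rewrite invfM mulrACA mulfV// mul1r.
Qed.

Lemma delta_gt0 d (k : nat) : (0 < d)%N -> 0 < delta d (k%:Z - 1) :> R.
Proof.
by move=> d0; rewrite deltaE divr_gt0// ?exprn_gt0// mulr_gt0// ltr0n.
Qed.

Lemma ln_delta_le d (k : nat) : (0 < d)%N ->
  ln (1 + (delta d (k%:Z - 1))^-1) <= (4 + ln d%:R) + k%:R :> R.
Proof.
move=> d0; rewrite deltaE invf_div exprVn invrK.
have d1 : 1 <= d%:R :> R by rewrite ler1n.
have p1 : 1 <= 2 ^+ k :> R by rewrite exprn_ege1// ler1n.
have p2 : 1 <= d%:R * 2 ^+ k :> R by rewrite mulr_ege1.
(* The factors [5] and [2] are written [1 + 4] and [1 + 1] to use [ln (1 + x) <= x]. *)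
apply: (@le_trans _ _ (ln ((1 + 4) * (d%:R * 2 ^+ k)))).
  by rewrite ler_ln ?posrE; lra.
have d0' : 0 < d%:R :> R by lra.
have p0 : 0 < 2 ^+ k :> R by lra.
have q0 : 0 < 1 + 4 :> R by lra.
rewrite lnM ?posrE ?mulr_gt0// lnM ?posrE//.
have -> : 2 = 1 + 1 :> R by lra.
have l5 : ln (1 + 4) <= 4 :> R by apply: le_ln1Dx; lra.
have l2 : ln (1 + 1) <= 1 :> R by apply: le_ln1Dx; lra.
rewrite lnXn; last by lra.
by rewrite -addrA !lerD// -[_ *+ k]mulr_natr ler_piMl.
Qed.

(** When [c < v], both sides cannot reject, and joint acceptance realizes the full gain. *)
Lemma round_regret_mistake (c v y : R) :
  round_regret c v y <= 0 \/
  [/\ c < v, round_regret c v y <= v - c &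
      ((c <= y) && ~~ (y <= v)) || (~~ (c <= y) && (y <= v))].
Proof.
rewrite /round_regret /gft.
have [vc|cv] := leP v c.
  left; rewrite max_r ?subr_le0//.
  by case: ifP => [/andP[? ?]|_]; lra.
rewrite max_l ?subr_ge0 ?(ltW cv)//.
case: (leP c y) => cy; case: (leP y v) => yv /=; rewrite ?subrr ?subr0;
  by [left|right|exfalso; lra].
Qed.

Lemma width_bounds d (K : set (d.-tuple R)) x p q :
  unit_ball d x -> K `<=` unit_ball d -> K p -> K q ->
  dotp p x - dotp q x <= width K x /\ width K x <= 2.
Proof.
move=> x1 K1 Kp Kq.
have ub2 : ubound [set dotp t1 x - dotp t2 x | t1 in K & t2 in K] 2.
  move=> _ [a Ka [b Kb <-]].
  have /andP[_ ?] := dotp_unit_ball (K1 _ Ka) x1.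
  by have /andP[? _] := dotp_unit_ball (K1 _ Kb) x1; lra.
split; last by apply: ge_sup => //; exists (dotp p x - dotp q x), p => //; exists q.
by apply: ub_le_sup; [exists 2|exists p => //; exists q].
Qed.

(** * Potential argument along one run of the algorithm *)

Section run.
Variables (d : nat) (ths thb : d.-tuple R) (x : nat -> d.-tuple R).
Variables (Phi : nat -> set (d.-tuple R)) (y : nat -> R).
Hypotheses (d0 : (0 < d)%N) (ths1 : unit_ball d ths) (thb1 : unit_ball d thb).
Hypothesis x1 : forall t, unit_ball d (x t).
Hypothesis run : msgft_run ths thb x Phi y.

Let PhiS t : Phi t.+1 = update (Phi t) (x t) (dotp ths (x t)) (dotp thb (x t)) (y t).
Proof. by have [_ /(_ t)[]] := run. Qed.

Lemma run_decr t : Phi t.+1 `<=` Phi t.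
Proof.
by rewrite PhiS /update; case: ifP => _; [|case: ifP => _ //]; move=> th [].
Qed.

(** If only the seller accepts, then [c <= y] and [v < y], so the lower cut keeps both parameters;
    the other case is symmetric. *)
Lemma run_invariant t :
  [/\ tconvex (Phi t), Phi t `<=` unit_ball d, Phi t ths & Phi t thb].
Proof.
elim: t => [|t [cP P1 Ps Pb]].
  by have [-> _] := run; split => //; exact: tconvex_unit_ball.
have lx := tlinear_dotp (x t).
split.
- rewrite PhiS /update; case: ifP => _; [|case: ifP => _ //].
  + exact: (@tconvexI _ _ (Phi t) [set th | dotp th (x t) <= y t]) cP (tconvex_le lx).
  + exact: (@tconvexI _ _ (Phi t) [set th | y t <= dotp th (x t)]) cP (tconvex_ge lx).
- by move=> th /run_decr /P1.
- rewrite PhiS /update; case: ifP => [/andP[]//|_].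
  by case: ifP => // /andP[]; rewrite -ltNge => /ltW.
- rewrite PhiS /update; case: ifP => [/andP[_]|_].
    by rewrite -ltNge => /ltW.
  by case: ifP => // /andP[].
Qed.

(** Every scale [k] is followed through all rounds, including those in which the algorithm works at
    another scale. *)
Let K k t := mink_ball (Phi t) (delta d (k%:Z - 1)).
Let v k t := fine (vol (K k t)).

Lemma vol_run k t (B : R) (dl := delta d (k%:Z - 1)) : vol (unit_ball d) = B%:E ->
  [/\ vol (K k t) = (v k t)%:E, dl ^+ d * B <= v k t & v k t <= (1 + dl) ^+ d * B].
Proof.
move=> BE; have [cP P1 Ps Pb] := run_invariant t.
have dl0 : 0 < dl by exact: delta_gt0.
have dl1 : 0 < (1 + dl) ^+ d by rewrite exprn_gt0// addr_gt0.
have := vol_mink_ball_le cP P1 dl0; have := vol_mink_ball_ge cP Ps dl0.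
rewrite BE exprVn /v -/(K k t); have := vol_ge0 (K k t).
case: (vol (K k t)) => [V _| |//].
  by rewrite -!EFinM !lee_fin ler_pdivrMl// => ? ?.
(* Infinite volume is excluded: contracted by a positive factor it would still exceed the finite
   [B]. *)
by move=> _ _; rewrite gt0_muley ?lte_fin ?invr_gt0.
Qed.

Lemma run_mistake t : round_regret (dotp ths (x t)) (dotp thb (x t)) (y t) <= 0 \/
  exists k, round_regret (dotp ths (x t)) (dotp thb (x t)) (y t) <= 2 * (2^-1) ^+ k /\
            v k t.+1 <= 7 / 8 * v k t.
Proof.
have [r0|[cv rcv mist]] := round_regret_mistake (dotp ths (x t)) (dotp thb (x t)) (y t).
  by left.
right; have [cP P1 Ps Pb] := run_invariant t.
have [w1 w2] := width_bounds (x1 t) P1 Pb Ps.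
have w0 : 0 < width (Phi t) (x t) by apply: lt_le_trans w1; rewrite subr_gt0.
have [k [sck kw wk]] := largest_scale_exists w0 w2.
exists k; split; first by apply: le_trans kw; exact: le_trans w1.
have [_ /(_ t)[/(_ w0 _ sck) half _]] := run.
have [B _ BE] := @vol_unit_ball R d d0.
have [VE _ _] := vol_run k t BE; have [VE' _ _] := vol_run k t.+1 BE.
(* The width is a supremum above [2^-k], so two points of [Phi t] already differ by more than that;
   this equals [4 * d * delta], the gap that the cut estimate requires. *)
have [_ [p Pp [q Pq <-]] pq] : exists2 z,
    [set dotp t1 (x t) - dotp t2 (x t) | t1 in Phi t & t2 in Phi t] z & (2^-1) ^+ k < z.
  by apply: sup_gt wk; exists (dotp ths (x t) - dotp ths (x t)), ths => //; exists ths.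
rewrite -/(K k t) VE in half.
have W : 4 * d%:R * delta d (k%:Z - 1) < dotp p (x t) - dotp q (x t).
  by rewrite deltaE mulrC divfK// mulf_neq0// pnatr_eq0 -lt0n.
have [lo hi] := vol_mink_ball_cut d0 cP (x1 t) (delta_gt0 k d0) Pq Pp W VE half.
rewrite -lee_fin -VE' /K PhiS /update.
by case/orP: mist => /[dup] /andP[m1 m2] -> //; rewrite (negbTE m1).
Qed.

Lemma run_regret_le T :
  \sum_(t < T) round_regret (dotp ths (x t)) (dotp thb (x t)) (y t) <=
  20 / - ln (7 / 8) * d%:R * (1 + ln d%:R).
Proof.
have [B B0 BE] := @vol_unit_ball R d d0.
have v0 k t : 0 < v k t.
  have [_ + _] := vol_run k t BE; apply: lt_le_trans.
  by rewrite mulr_gt0// exprn_gt0// delta_gt0.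
have kappa0 : 0 < - ln (7 / 8 : R) by rewrite oppr_gt0 ln_lt0//; lra.
have P_ni k t : ln (v k t.+1) <= ln (v k t).
  rewrite ler_ln ?posrE// -lee_fin.
  have [<- _ _] := vol_run k t BE; have [<- _ _] := vol_run k t.+1 BE.
  have [cP _ _ _] := run_invariant t; have [cP' _ _ _] := run_invariant t.+1.
  apply: le_vol; [exact: tconvex_mink_ball..|].
  exact/mink_ball_sub/run_decr.
have w0 k : 0 <= 2 * (2^-1 : R) ^+ k by rewrite mulr_ge0// exprn_ge0.
have drop t : round_regret (dotp ths (x t)) (dotp thb (x t)) (y t) <= 0 \/
    exists k, round_regret (dotp ths (x t)) (dotp thb (x t)) (y t) <= 2 * (2^-1) ^+ k /\
              ln (v k t.+1) <= ln (v k t) - - ln (7 / 8).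
  have [|[k [rk vk]]] := run_mistake t; [by left|right; exists k; split => //].
  have p78 : 0 < 7 / 8 :> R by lra.
  by rewrite opprK -lnM ?posrE// mulrC ler_ln ?posrE ?mulr_gt0.
have [M /le_trans] := multiscale_sum kappa0 w0 P_ni drop T; apply.
rewrite -!mulrA mulrCA ler_wpM2l ?invr_ge0 ?(ltW kappa0)//.
(* The ratio of the upper to the lower volume bound is [(1 + 1/delta) ^ d]; the volume of the ball
   cancels. *)
have range k : ln (v k 0) - ln (v k T) <= d%:R * ((4 + ln d%:R) + k%:R).
  have [_ _ hi] := vol_run k 0 BE; have [_ lo _] := vol_run k T BE.
  have dl0 := @delta_gt0 d k d0; set dl := delta d (k%:Z - 1) in hi lo dl0.
  have i0 : 0 < 1 + dl^-1 by rewrite addr_gt0 ?invr_gt0.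
  apply: (@le_trans _ _ (ln ((1 + dl^-1) ^+ d))); last first.
    by rewrite lnXn// -[_ *+ d]mulr_natl ler_wpM2l// ln_delta_le.
  rewrite lerBlDr -lnM ?posrE ?exprn_gt0// ler_ln ?posrE ?mulr_gt0 ?exprn_gt0//.
  apply: (le_trans hi); apply: (@le_trans _ _ ((1 + dl^-1) ^+ d * (dl ^+ d * B))).
    by rewrite mulrA -exprMn mulrDl mul1r mulVf ?gt_eqF// addrC.
  by rewrite ler_wpM2l// exprn_ge0// ltW.
apply: (@le_trans _ _ (2 * d%:R * \sum_(k < M) (2^-1) ^+ k * ((4 + ln d%:R) + k%:R))).
  rewrite mulr_sumr; apply: ler_sum => k _.
  rewrite -!mulrA ler_wpM2l// (mulrCA d%:R) ler_wpM2l ?exprn_ge0//; exact: range.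
have ld0 : 0 <= ln d%:R :> R by rewrite ln_ge0// ler1n.
have := @geometric_moment_le (4 + ln d%:R) M (addr_ge0 (ler0n _ 4) ld0).
have d1 : 0 <= d%:R :> R by [].
set S := \sum_(k < M) _ => hS.
(* The moment bound is [10 + 2 * ln d]; with the factor [2] from the weights this yields the
   constant [20]. *)
have : d%:R * S <= d%:R * (10 * (1 + ln d%:R)) by apply: ler_wpM2l => //; lra.
by move=> ?; lra.
Qed.
End run.

End regret.

Theorem theorem5p3 (R : realType) :
  exists C : R, 0 < C /\
  forall (d : nat), (0 < d)%N ->
  forall (ths thb : d.-tuple R) (x : nat -> d.-tuple R)
         (Phi : nat -> set (d.-tuple R)) (y : nat -> R),
    unit_ball d ths -> unit_ball d thb ->
    (forall t, unit_ball d (x t)) ->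
    msgft_run ths thb x Phi y ->
    forall T : nat,
      \sum_(t < T) round_regret (dotp ths (x t)) (dotp thb (x t)) (y t)
      <= C * d%:R * (1 + ln d%:R).
Proof.
exists (20 / - ln (7 / 8)); split.
  by rewrite divr_gt0// oppr_gt0 ln_lt0//; lra.
move=> d d0 ths thb x Phi y ths1 thb1 x1 run T.
exact: run_regret_le d0 ths1 thb1 x1 run T.
Qed.
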